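(* Let $\{\boldsymbol{\xi}_t\}_{0\le t\le 1}$ be an $n$-dimensional generalised Liouville process (GLP). Then: 1. The increments of $\{\boldsymbol{\xi}_t\}_{0\le t\le 1}$ have a generalised multivariate Liouville distribution; that is, for all integers $k_1,\dots,k_n\ge 1$ and all partitions $0=t^i_0<t^i_1<\cdots<t^i_{k_i}=1$, $i=1,\dots,n$, the random vector with coordinates $\xi^{(i)}_{t^i_j}-\xi^{(i)}_{t^i_{j-1}}$ ($1\le j\le k_i$, $1\le i\le n$) has a generalised multivariate Liouville distribution. 2. The terminal value $\boldsymbol{\xi}_1$ has a generalised multivariate Liouville distribution.
   Context: For $\mathbf{x}\in\mathbb{R}^n$ write $\mathbf{1}\cdot\mathbf{x}=\sum_i x_i$. All processes are càdlàg on a probability space $(\Omega,\mathcal{F},\mathbb{P})$. Lévy random bridge (LRB). Let $T>0$, let $\nu$ be a probability law on $\mathbb{R}$, and let $\{X_t\}$ be a real-valued Lévy process such that $X_t$ has a density $f_t$ for all $t\in(0,T]$, with $f_t(x)=\int_{\mathbb{R}}f_{t-s}(x-y)f_s(y)\,dy$ for $0<s<t\le T$, $x\in\mathbb{R}$, and $0<f_T(z)<\infty$ for $\nu$-a.e. $z$. A process $\{L_t\}_{0\le t\le T}$ is an LRB with generating law $\nu$ if $L_T$ has law $\nu$ and, for all $k\ge 1$, $0<t_1<\cdots<t_k<T$, $(x_1,\dots,x_k)\in\mathbb{R}^k$ and $\nu$-a.e. $z$, $\mathbb{P}(L_{t_1}\le x_1,\dots,L_{t_k}\le x_k\mid L_T=z)=\mathbb{P}(X_{t_1}\le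 x_1,\dots,X_{t_k}\le x_k\mid X_T=z)$. Equivalently (with $t_0=0$, $x_0=0$), $$\mathbb{P}(L_{t_1}\in dx_1,\dots,L_{t_k}\in dx_k,L_T\in dz)=\prod_{i=1}^k\big(f_{t_i-t_{i-1}}(x_i-x_{i-1})\,dx_i\big)\frac{f_{T-t_k}(z-x_k)}{f_T(z)}\,\nu(dz).$$ Generalised Liouville process (GLP). Let $n\ge2$, $m_1,\dots,m_n>0$, $u_0=0$, $u_i=u_{i-1}+m_i$. A process $\{\boldsymbol{\xi}_t\}_{0\le t\le1}$ is an $n$-dimensional GLP with generating law $\nu$ and activity parameter $\mathbf{m}=(m_1,\dots,m_n)^\top$ if it is equal in law to the process with coordinates $L_{tm_i+u_{i-1}}-L_{u_{i-1}}$, $i=1,\dots,n$, $0\le t\le1$, for some LRB $\{L_t\}_{0\le t\le u_n}$ with generating law $\nu$. It is assumed throughout that $\nu$ has no continuous singular part. Generalised multivariate Liouville distribution. Let $\nu$ be a probability law on $\mathbb{R}$ and $\{\phi_a:0<a\le A<\infty\}$ a family of functions with $\phi_a*\phi_b=\phi_{a+b}$ for $a+b\le A$. A random vector $(X_1,\dots,X_N)$ has a generalised multivariate Liouville distribution if its joint law is of the form $$\mathbb{P}\Big(X_1\in dx_1,\dots,X_{N-1}\in dx_{N-1},\sum_{i=1}^N X_i\in dz\Big)=\frac{\phi_{a_N}\big(z-\sum_{i=1}^{N-1}x_i\big)\,\nu(dz)}{\phi_{\mathbf{1}\cdot\mathbf{a}}(z)}\prod_{i=1}^{N-1}\phi_{a_i}(x_i)\,dx_i,$$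 for some $\mathbf{a}=(a_1,\dots,a_N)^\top\in\mathbb{R}_+^N$ with $\mathbf{1}\cdot\mathbf{a}\le A$. *)

(* Defs.v *)
From HB Require Import structures.
From mathcomp Require Import all_boot all_order all_algebra.
From mathcomp Require Import all_classical all_reals all_analysis.
From mathcomp Require Import measurable_realfun.

Set Implicit Arguments.
Unset Strict Implicit.
Unset Printing Implicit Defensive.

Import Order.TTheory GRing.Theory Num.Theory.
Import numFieldNormedType.Exports.

Local Open Scope classical_set_scope.
Local Open Scope ring_scope.

(* Integral of g over the box A_0 x ... x A_(k-1) of R^k with respect to
   k-dimensional Lebesgue measure, written as an iterated integral (it is only
   used for nonnegative measurable g, where Tonelli's theorem applies). *)
Fixpoint box_integral (R : realType) (k : nat) :
    ('I_k -> set R) -> (k.-tuple R -> \bar R) -> \bar R :=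
  match k return ('I_k -> set R) -> (k.-tuple R -> \bar R) -> \bar R with
  | 0%N => fun _ g => g [tuple]
  | k'.+1 => fun A g =>
      (\int[@lebesgue_measure R]_(y in A ord0)
         box_integral (fun i => A (lift ord0 i))
                      (fun v : k'.-tuple R => g [tuple of y :: v]))%E
  end.

Definition cadlag_on (R : realType) (S : R) (h : R -> R) : Prop :=
  (forall t, 0 <= t < S -> h s @[s --> t^'+] --> h t) /\
  (forall t, 0 < t <= S -> cvg (h s @[s --> t^'-])).

(* Densities take values in [0, +oo]: the density of a Levy process may be
   infinite at some points (e.g. variance gamma at the origin). *)
Definition is_density d (T : measurableType d) (R : realType)
    (P : probability T R) (X : {RV P >-> R}) (g : R -> \bar R) : Prop :=
  [/\ measurable_fun [set: R] g,
      forall x, (0 <= g x)%E &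
      forall A : set R, measurable A ->
        P (X @^-1` A) = (\int[@lebesgue_measure R]_(x in A) g x)%E].

Definition convolution (R : realType) (g h : R -> \bar R) (x : R) : \bar R :=
  (\int[@lebesgue_measure R]_y (g (x - y)%R * h y))%E.

Definition independent_increments d (T : measurableType d) (R : realType)
    (P : probability T R) (X : R -> {RV P >-> R}) : Prop :=
  forall (k : nat) (t : nat -> R) (B : 'I_k -> set R),
    0 <= t 0%N -> (forall i, (i < k)%N -> t i < t i.+1) ->
    (forall i, measurable (B i)) ->
    P [set w | forall i : 'I_k, B i (X (t i.+1) w - X (t i) w)] =
    (\prod_(i < k) P [set w | B i (X (t i.+1) w - X (t i) w)%R])%E.

Definition stationary_increments d (T : measurableType d) (R : realType)
    (P : probability T R) (X : R -> {RV P >-> R}) : Prop :=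
  forall (s h : R) (B : set R), 0 <= s -> 0 <= h -> measurable B ->
    P [set w | B (X (s + h) w - X s w)] = P [set w | B (X h w - X 0 w)].

(* Processes are indexed by R; only the times in [0, +oo[ (here), [0, S] (for
   bridges) and [0, 1] (for generalised Liouville processes) are relevant. *)
Definition is_levy d (T : measurableType d) (R : realType)
    (P : probability T R) (X : R -> {RV P >-> R}) : Prop :=
  [/\ {ae P, forall w, X 0 w = 0},
      independent_increments X,
      stationary_increments X &
      forall (w : T) (S : R), 0 < S -> cadlag_on S (fun t => X t w)].

Definition levy_densities d (T : measurableType d) (R : realType)
    (P : probability T R) (X : R -> {RV P >-> R}) (S : R)
    (f : R -> R -> \bar R) : Prop :=
  (forall t, 0 < t <= S -> is_density (X t) (f t)) /\
  (forall s t x, 0 < s -> s < t -> t <= S ->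
     f t x = convolution (f (t - s)) (f s) x).

(* Density at (y_1, ..., y_k) of (X_(t_1), ..., X_(t_k)) given X_S = z, where X
   has transition densities f, t_0 = 0 and y_0 = 0. It is meaningful when
   0 < f_S(z) < +oo. *)
Definition bridge_density (R : realType) (f : R -> R -> \bar R) (S : R)
    (k : nat) (t : nat -> R) (z : R) (y : k.-tuple R) : \bar R :=
  let y0 := 0 :: val y in
  ((\prod_(i < k) f (t i.+1 - t i)%R (y0`_i.+1 - y0`_i)%R) *
     f (S - t k)%R (z - y0`_k)%R / f S z)%E.

(* P(X_(t_1) <= x_0, ..., X_(t_k) <= x_(k-1) | X_S = z), the elementary
   conditional probability given by the densities; it is needed for almost all
   z with respect to a law that need not be dominated by the law of X_S. *)
Definition bridge_cdf (R : realType) (f : R -> R -> \bar R) (S : R)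
    (k : nat) (t : nat -> R) (x : 'I_k -> R) (z : R) : \bar R :=
  box_integral (fun i => [set u | u <= x i]) (@bridge_density R f S k t z).

(* g is a version of z |-> P(E | Y = z); such a g is unique up to a null set
   for the law of Y. *)
Definition conditional_prob_version d (T : measurableType d) (R : realType)
    (P : probability T R) (E : set T) (Y : {RV P >-> R})
    (g : R -> \bar R) : Prop :=
  measurable_fun [set: R] g /\
  forall B : set R, measurable B ->
    P (E `&` Y @^-1` B) = (\int[distribution P Y]_(z in B) g z)%E.

Definition lrb_from d (T : measurableType d) (R : realType)
    (P : probability T R) (S : R) (nu : probability (measurableTypeR R) R)
    (f : R -> R -> \bar R) (L : R -> {RV P >-> R}) : Prop :=
  [/\ forall w : T, cadlag_on S (fun t => L t w),
      forall B : set R, measurable B -> distribution P (L S) B = nu B &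
      forall (k : nat) (t : nat -> R) (x : 'I_k -> R),
        (0 < k)%N -> t 0%N = 0 -> (forall i, (i < k)%N -> t i < t i.+1) ->
        t k < S ->
        conditional_prob_version [set w | forall i : 'I_k, L (t i.+1) w <= x i]
          (L S) (bridge_cdf f S t x)].

Definition is_lrb d (T : measurableType d) (R : realType)
    (P : probability T R) (S : R) (nu : probability (measurableTypeR R) R)
    (L : R -> {RV P >-> R}) : Prop :=
  0 < S /\
  exists (d' : measure_display) (T' : measurableType d')
         (Q : probability T' R) (X : R -> {RV Q >-> R}) (f : R -> R -> \bar R),
    [/\ is_levy X,
        levy_densities X S f,
        {ae nu, forall z, (0 < f S z < +oo)%E} &
        lrb_from S nu f L].

(* Equality in law, as processes indexed by [0, 1], that is, equality of all
   finite-dimensional laws. *)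
Definition equal_in_law d d' (T : measurableType d) (T' : measurableType d')
    (R : realType) (P : probability T R) (P' : probability T' R) (n : nat)
    (xi : 'I_n -> R -> T -> R) (zeta : 'I_n -> R -> T' -> R) : Prop :=
  forall (k : nat) (c : 'I_k -> 'I_n) (t : 'I_k -> R) (B : set (k.-tuple R)),
    (forall j, 0 <= t j <= 1) -> measurable B ->
    P [set w | B [tuple xi (c j) (t j) w | j < k]] =
    P' [set w | B [tuple zeta (c j) (t j) w | j < k]].

(* partial_sum m i is the sum m_1 + ... + m_i. *)
Definition partial_sum (R : realType) (n : nat) (m : 'I_n -> R) (i : nat) : R :=
  \sum_(j < n | (j < i)%N) m j.

Definition no_continuous_singular_part (R : realType)
    (nu : probability (measurableTypeR R) R) : Prop :=
  exists nuc nud : {measure set (measurableTypeR R) -> \bar R},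
    [/\ nuc `<< @lebesgue_measure R,
        exists2 D : set R, countable D & nud (~` D) = 0%E &
        forall B : set R, measurable B -> nu B = (nuc B + nud B)%E].

(* As the index i : 'I_n starts at 0, the time u_(i-1) of the coordinate
   number i in {1, ..., n} is partial_sum m i here. *)
Definition is_glp d (T : measurableType d) (R : realType)
    (P : probability T R) (n : nat) (nu : probability (measurableTypeR R) R)
    (m : 'I_n -> R) (xi : 'I_n -> R -> {RV P >-> R}) : Prop :=
  (forall (w : T) i, cadlag_on 1 (fun t => xi i t w)) /\
  exists (d' : measure_display) (T' : measurableType d')
         (P' : probability T' R) (L : R -> {RV P' >-> R}),
    is_lrb (partial_sum m n) nu L /\
    equal_in_law P P' xi
      (fun i t w =>
         L (t * m i + partial_sum m i) w - L (partial_sum m i) w).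

(* Only phi a for 0 < a <= A matters. *)
Definition convolution_family (R : realType) (A : R)
    (phi : R -> R -> \bar R) : Prop :=
  [/\ forall a, 0 < a <= A -> measurable_fun [set: R] (phi a),
      forall a x, 0 < a <= A -> (0 <= phi a x)%E &
      forall a b x, 0 < a -> 0 < b -> a + b <= A ->
        convolution (phi a) (phi b) x = phi (a + b) x].

(* The joint law of (X_1, ..., X_(N-1), X_1 + ... + X_N), N = M.+1, for the
   weights a, evaluated on products of Borel sets. *)
Definition liouville_law d (T : measurableType d) (R : realType)
    (P : probability T R) (nu : probability (measurableTypeR R) R)
    (phi : R -> R -> \bar R) (M : nat) (a : 'I_M.+1 -> R)
    (X : 'I_M.+1 -> T -> R) : Prop :=
  let init := widen_ord (leqnSn M) in
  forall (B : 'I_M -> set R) (C : set R),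
    (forall i, measurable (B i)) -> measurable C ->
    P [set w | (forall i : 'I_M, B i (X (init i) w)) /\ C (\sum_i X i w)] =
    (\int[nu]_(z in C)
       box_integral B (fun x : M.-tuple R =>
         phi (a ord_max) (z - \sum_(i < M) tnth x i)%R / phi (\sum_i a i)%R z *
         \prod_(i < M) phi (a (init i)) (tnth x i)))%E.

(* The vector must be nonempty: the law is expressed by singling out its last
   coordinate. *)
Definition gen_multivariate_liouville d (T : measurableType d) (R : realType)
    (P : probability T R) (N : nat) : ('I_N -> T -> R) -> Prop :=
  match N return ('I_N -> T -> R) -> Prop with
  | 0%N => fun _ => False
  | M.+1 => fun X =>
      exists (nu : probability (measurableTypeR R) R) (A : R)
             (phi : R -> R -> \bar R) (a : 'I_M.+1 -> R),
        [/\ 0 < A, convolution_family A phi,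
            (forall i, 0 < a i) /\ \sum_i a i <= A,
            {ae nu, forall z, (0 < phi (\sum_i a i)%R z < +oo)%E} &
            liouville_law P nu phi a X]
  end.

(* Increments of xi along the partitions t i of [0, 1] into k i intervals,
   listed coordinate by coordinate: tagnat.sig1 s and tagnat.sig2 s are the
   pair (i, j) of rank s in lexicographic order. *)
Definition increments d (T : measurableType d) (R : realType) (n : nat)
    (xi : 'I_n -> R -> T -> R) (k : 'I_n -> nat) (t : 'I_n -> nat -> R)
    (s : 'I_(\sum_i k i)) (w : T) : R :=
  let i := tagnat.sig1 s in
  let j := tagnat.sig2 s : nat in
  xi i (t i j.+1) w - xi i (t i j) w.
Arguments increments {d T R n} xi k t s w.

(* Main.v *)
Require Import Defs.
From HB Require Import structures.
From mathcomp Require Import all_boot all_order all_algebra.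
From mathcomp Require Import all_classical all_reals all_analysis.
From mathcomp Require Import measurable_realfun.

Set Implicit Arguments.
Unset Strict Implicit.
Unset Printing Implicit Defensive.

Import Order.TTheory GRing.Theory Num.Theory.
Import numFieldNormedType.Exports.
Local Open Scope classical_set_scope.
Local Open Scope ring_scope.

(** Listed coordinate by coordinate, the increments of a generalised Liouville
    process are, in law, the increments of a Levy random bridge along one
    partition of its time interval [0, S], S = m_1 + ... + m_n: the interval of
    coordinate i + 1 starts where that of coordinate i ends
    ([partial_sum_bridge_steps]). The terminal value is the case of the coarsest
    partition. So it suffices to treat the increments of a bridge L along a
    partition 0 = tau_0 < ... < tau_(M + 1) = S ([liouville_of_lrb]). The
    convolution family is that of the transition densities f of the driving
    process, the parameters are the lengths of the steps, and nu is the law of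
    L_S.

    Given L_S = z, the positions (y_1, ..., y_M) at the interior times have
    density f_(tau_1)(y_1) f_(tau_2 - tau_1)(y_2 - y_1) ...
    f_(S - tau_M)(z - y_M) / f_S(z). In the variables x_i = y_i - y_(i - 1) this
    is the Liouville density, and the substitution is a translation in each
    variable ([iterated_integral_increments], [bridge_density_liouville]).

    Two points need an argument. The bridge is defined through the conditional
    probabilities of lower orthants, whereas conditions on increments involve
    other sets of positions; the formula extends to all Borel sets because
    orthants determine finite measures ([bridge_joint_law]). Moreover the first
    increment is L_(tau_1) - L_0, and nothing in the finite-dimensional laws of
    the bridge mentions L_0: it has to be shown that L_0 = 0 almost surely
    ([lrb_start_zero]). For a fixed intermediate time u, the law up to time u of
    the bridge pinned at z has density f_(S - u)(z - X_u) / f_S(z) with respect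
    to the driving process X ([levy_bridge_integral]). As X_s tends to 0 when s
    tends to 0, dominated convergence shows that the pinned bridges tend to 0 in
    probability, for every z with 0 < f_S(z) < +oo; averaging over nu and using
    the right continuity of L gives L_0 = 0. *)

(** * Translation invariance of the Lebesgue integral and measurability *)

Section lebesgue_shift.
Context {R : realType}.
Let mu := @lebesgue_measure R.

Let measurable_shift (p : R) :
  measurable_fun [set: measurableTypeR R]
    ((fun y => y - p) : measurableTypeR R -> measurableTypeR R).
Proof. exact: (@measurable_funB _ _ R setT id (cst p)). Qed.

Lemma lebesgue_measure_shift (p : R) (A : set R) : measurable A ->
  pushforward mu ((fun y => y - p) : _ -> measurableTypeR R) A = mu A.
Proof.
move=> mA; have mS := measurable_shift p.
apply/esym/lebesgue_measure_unique => //= _ [[a b]] _ <-.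
rewrite /pushforward/=.
have -> : (fun y : R => y - p) @^-1` `]a, b] = `]a + p, b + p]%classic.
  by apply/seteqP; split => y /=; rewrite !in_itv/= ltrBrDr lerBlDr.
rewrite !lebesgue_measure_itv/= !lte_fin ltrD2r.
by case: ifP => // _; rewrite -!EFinB opprD addrACA subrr addr0.
Qed.

Lemma ge0_integral_shift (p : R) (f : R -> \bar R) :
  measurable_fun [set: R] f -> (forall x, (0 <= f x)%E) ->
  (\int[mu]_y f (y - p)%R = \int[mu]_y f y)%E.
Proof.
move=> mf f0; have mS := measurable_shift p.
transitivity (\int[pushforward mu
  ((fun y => y - p)%R : _ -> measurableTypeR R)]_y f y)%E.
  by rewrite ge0_integral_pushforward.
by apply: eq_measure_integral => //= *; exact: lebesgue_measure_shift.
Qed.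

End lebesgue_shift.

Lemma measurable_inve (R : realType) d (T : measurableType d)
    (f : T -> \bar R) :
  measurable_fun setT f -> (forall x, (0 <= f x)%E) ->
  measurable_fun setT (fun x => ((f x)^-1)%E).
Proof.
move=> mf f0.
rewrite (_ : (fun x => _) = (fun x => if f x == 0%E then +oo%E else
  if f x == +oo%E then 0%E else (powR (fine (f x)) (-1))%:E)); last first.
  apply/funext => x; have := f0 x.
  case: (f x) => [r| |]//=.
    by rewrite lee_fin => r0; rewrite inver eqe powR_inv1//.
apply: measurable_fun_ifT => //=; first by apply: measurable_fun_eqe.
apply: measurable_fun_ifT => //=; first by apply: measurable_fun_eqe.
apply/measurable_EFinP.
apply: (@measurableT_comp _ _ _ _ _ _ (fun x => powR x (-1))) => //.
exact: measurableT_comp.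
Qed.

Lemma emeasurable_prod (R : realType) d (T : measurableType d) (I : Type)
    (s : seq I) (h : I -> T -> \bar R) :
  (forall i, measurable_fun setT (h i)) ->
  measurable_fun setT (fun x => \prod_(i <- s) h i x)%E.
Proof.
move=> mh; elim: s => [|i s IH].
  by under eq_fun do rewrite big_nil; exact: measurable_cst.
by under eq_fun do rewrite big_cons; exact: emeasurable_funM.
Qed.

Lemma measurable_nth_tuple (R : realType) (k i : nat) :
  measurable_fun setT (fun v : k.-tuple R => v`_i).
Proof.
have [ik|ki] := ltnP i k; last first.
  by under eq_fun do rewrite nth_default ?size_tuple//; exact: measurable_cst.
have := @measurable_tnth _ R k (Ordinal ik).
by apply: eq_measurable_fun => v _; rewrite (tnth_nth 0).
Qed.

Lemma measurable_mktuple (R : realType) d (T : measurableType d) (k : nat)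
    (g : 'I_k -> T -> R) :
  (forall i, measurable_fun setT (g i)) ->
  measurable_fun setT (fun w => [tuple g i w | i < k]).
Proof.
move=> mg; apply/measurable_fun_tnthP => i.
by apply: eq_measurable_fun (mg i) => w _ /=; rewrite tnth_mktuple.
Qed.

Lemma measurable_box (R : realType) (k : nat) (B : 'I_k -> set R) :
  (forall i, measurable (B i)) ->
  measurable [set v : k.-tuple R | forall i, B i (tnth v i)].
Proof.
move=> mB; rewrite (_ : mkset _ = \big[setI/setT]_(i < k)
    ((fun v : k.-tuple R => tnth v i) @^-1` B i)); last first.
  by rewrite -bigcap_seq; apply/seteqP; split => v vB i //=;
    apply: vB; rewrite /= mem_index_enum.
apply: bigsetI_measurable => i _; rewrite -[X in measurable X]setTI.
exact: measurable_tnth.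
Qed.

Lemma measurable_norm_gt (R : realType) (e : R) :
  measurable [set y : R | e < `|y|].
Proof.
rewrite (_ : mkset _ = (fun y => `|y|) @^-1` `]e, +oo[); last first.
  by apply/seteqP; split => y /=; rewrite in_itv/= andbT.
by rewrite -[X in measurable X]setTI; exact: normr_measurable.
Qed.

Lemma ae_eq_measure d (T : measurableType d) (R : realType)
    (m : {measure set T -> \bar R}) (A B : set T) :
  measurable A -> measurable B -> {ae m, forall w, A w <-> B w} -> m A = m B.
Proof.
move=> mA mB AB; rewrite -[A]setIT -[B]setIT -!integral_indic//.
apply: ae_eq_integral => //.
- by apply/measurable_EFinP; exact: measurable_indic.
- by apply/measurable_EFinP; exact: measurable_indic.
apply: filterS AB => w AB _; rewrite !indicE; congr (_%:R%:E).
by congr nat_of_bool; apply/idP/idP => /set_mem/AB ?; apply/mem_set.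
Qed.

(** * Iterated Lebesgue integrals on real tuples *)

Section iterated_integral.
Context {R : realType}.
Let mu := @lebesgue_measure R.

Definition iterated_integral (k : nat) (g : k.-tuple R -> \bar R) : \bar R :=
  box_integral (fun _ => setT) g.

(** The change of variables, of Jacobian one, from the positions of a path
    started at p to its increments. *)
Definition increments_from (p : R) (k : nat) (v : k.-tuple R) : k.-tuple R :=
  [tuple tnth v i - (p :: v)`_i | i < k].

Lemma increments_from_cons (p y : R) (k : nat) (v : k.-tuple R) :
  increments_from p [tuple of y :: v] =
  [tuple of y - p :: increments_from y v].
Proof.
apply: eq_from_tnth => i; rewrite tnth_mktuple.
have [j ->|->] := unliftP ord0 i; last by rewrite !tnth0.
by rewrite !tnthS tnth_mktuple.
Qed.

Lemma iterated_integral_ge0 (k : nat) (g : k.-tuple R -> \bar R) :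
  (forall v, (0 <= g v)%E) -> (0 <= iterated_integral g)%E.
Proof.
elim: k g => [|k IH] g g0; first exact: g0.
by apply: integral_ge0 => y _; apply: IH.
Qed.

Lemma measurable_cons_pair d (X : measurableType d) (k : nat)
  (g : X * k.+1.-tuple R -> \bar R) : measurable_fun setT g ->
  measurable_fun setT (fun u : X * R * k.-tuple R =>
    g (u.1.1, [tuple of u.1.2 :: u.2])).
Proof.
move=> mg; apply: (measurableT_comp mg); apply: measurable_fun_pair => /=.
  exact: measurableT_comp.
apply: measurable_cons => //; exact: measurableT_comp.
Qed.

(** Tonelli's theorem, once per coordinate. The parameter space has to vary in
    the induction, since it absorbs the outermost integration variable. *)
Lemma measurable_iterated_integral d (X : measurableType d) (k : nat)
    (g : X * k.-tuple R -> \bar R) :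
  measurable_fun setT g -> (forall u, (0 <= g u)%E) ->
  measurable_fun setT (fun x => iterated_integral (fun v => g (x, v))).
Proof.
elim: k d X g => [|k IH] d X g mg g0.
  by apply: (measurableT_comp mg); exact: measurable_fun_pair.
have := IH _ _ _ (measurable_cons_pair mg) (fun u => g0 _).
move/(measurable_fun_fubini_tonelli_F (m2 := mu)); apply => -[x y] /=.
by apply: iterated_integral_ge0.
Qed.

Lemma measurable_iterated_integral_cons (k : nat)
    (g : k.+1.-tuple R -> \bar R) :
  measurable_fun setT g -> (forall v, (0 <= g v)%E) ->
  measurable_fun setT
    (fun y : R =>
       iterated_integral (fun v : k.-tuple R => g [tuple of y :: v])).
Proof.
move=> mg g0.
apply: (@measurable_iterated_integral _ _ k
  (fun u : R * k.-tuple R => g [tuple of u.1 :: u.2])) => //.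
by apply: (measurableT_comp mg); apply: measurable_cons.
Qed.

Lemma measurable_consr (k : nat) (g : k.+1.-tuple R -> \bar R) (y : R) :
  measurable_fun setT g ->
  measurable_fun setT (fun v : k.-tuple R => g [tuple of y :: v]).
Proof. by move=> mg; apply: (measurableT_comp mg); exact: measurable_cons. Qed.

Lemma iterated_integral_nneseries (k : nat) (g : nat -> k.-tuple R -> \bar R) :
  (forall n, measurable_fun setT (g n)) -> (forall n v, (0 <= g n v)%E) ->
  (iterated_integral (fun v => \sum_(n <oo) g n v) =
   \sum_(n <oo) iterated_integral (g n))%E.
Proof.
elim: k g => [|k IH] g mg g0 //.
rewrite /iterated_integral/= -/mu.
transitivity (\int[mu]_y \sum_(n <oo)
    iterated_integral (fun v : k.-tuple R => g n [tuple of y :: v]))%E.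
  apply: eq_integral => y _; rewrite -IH// => n; exact: measurable_consr.
rewrite integral_nneseries// => n.
  exact: measurable_iterated_integral_cons.
by move=> y _; apply: iterated_integral_ge0.
Qed.

Lemma iterated_integral0 (k : nat) :
  iterated_integral (fun _ : k.-tuple R => 0%E) = 0%E.
Proof.
by elim: k => [|k IH]//; rewrite /iterated_integral/= integral0_eq.
Qed.

(** Integrals over boxes become integrals over the whole space: only then can
    the domain be replaced by an arbitrary measurable set. *)
Lemma box_integralE (k : nat) (A : 'I_k -> set R) (g : k.-tuple R -> \bar R) :
  box_integral A g =
  iterated_integral (g \_ [set v | forall i, A i (tnth v i)]).
Proof.
elim: k A g => [|k IH] A g.
  rewrite /iterated_integral/= patchE mem_set//.
  by move=> [].
rewrite /= integral_mkcond; apply: eq_integral => y _; rewrite patchE.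
case: ifPn => [/set_mem yA|/negP yA].
  rewrite IH; congr box_integral; apply/funext => v; rewrite !patchE.
  congr (if _ then _ else _); apply/idP/idP => /set_mem vA; apply/mem_set => i.
    by have [j ->|->] := unliftP ord0 i; rewrite ?tnth0// tnthS.
  by have := vA (lift ord0 i); rewrite tnthS.
rewrite -[LHS](iterated_integral0 k).
congr box_integral; apply/funext => v; rewrite patchE ifF//.
apply/negP => /set_mem /(_ ord0); rewrite tnth0 => yA'.
by apply: yA; exact/mem_set.
Qed.

(** The innermost integral sees the previous position as a constant, so the
    substitution is a translation in each coordinate, from the inside out. *)
Lemma iterated_integral_increments (k : nat) (p : R)
    (g : k.-tuple R -> \bar R) :
  measurable_fun setT g -> (forall v, (0 <= g v)%E) ->
  iterated_integral (fun v => g (increments_from p v)) = iterated_integral g.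
Proof.
elim: k p g => [|k IH] p g mg g0.
  by congr (g _); apply: eq_from_tnth => -[].
transitivity (\int[mu]_y
    iterated_integral (fun v : k.-tuple R => g [tuple of (y - p)%R :: v]))%E.
  apply: eq_integral => y _; rewrite -(IH y)//; last exact: measurable_consr.
  by congr box_integral; apply/funext => v; rewrite increments_from_cons.
rewrite (@ge0_integral_shift R p
  (fun y => iterated_integral (fun v : k.-tuple R => g [tuple of y :: v])))//.
  exact: measurable_iterated_integral_cons.
by move=> y; apply: iterated_integral_ge0.
Qed.

End iterated_integral.

(** * Measures on real tuples are determined by lower orthants *)

Section lower_orthants.
Context {R : realType} (k : nat).

Definition lower_orthant (x : 'I_k -> R) : set (k.-tuple R) :=
  [set v | forall i, tnth v i <= x i].

Lemma measurable_lower_orthant x : measurable (lower_orthant x).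
Proof.
apply: (measurable_box (B := fun i => [set u | u <= x i])) => i.
rewrite (_ : mkset _ = `]-oo, x i]%classic); first exact: measurable_itv.
by apply/seteqP; split => u /=; rewrite in_itv.
Qed.

Lemma lower_orthant_exhaust (v : k.-tuple R) :
  exists n, forall i, tnth v i <= n%:R.
Proof.
exists (Num.truncn (\sum_j `|tnth v j|)).+1 => j.
rewrite (le_trans (ler_norm _))//.
apply: (@le_trans _ _ (\sum_j `|tnth v j|)); last exact/ltW/truncnS_gt.
by rewrite (bigD1 j)//= lerDl sumr_ge0.
Qed.

(** The half-space of points whose i-th coordinate is at most x is the
    increasing union of the orthants with corner x in direction i and n in the
    other directions, so the coordinate maps are measurable for the
    sigma-algebra generated by orthants. *)
Lemma measurable_tuple_orthants :
  @measurable _ (k.-tuple R) = <<s range lower_orthant >>.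
Proof.
apply/seteqP; split; last first.
  apply: smallest_sub; first exact: sigma_algebra_measurable.
  by move=> _ [x _ <-]; exact: measurable_lower_orthant.
apply: smallest_sub; first exact: smallest_sigma_algebra.
rewrite -bigcup_seq => A [i _].
move=> [B mB <-].
have : measurable_fun setT
   ((fun v => tnth v i) : g_sigma_algebraType (range lower_orthant) -> R).
  apply: (measurability _ (RGenOInfty.measurableE R)) => _ [_ [x ->] <-].
  rewrite setTI.
  rewrite (_ : _ @^-1` _ = ~` \bigcup_n lower_orthant
      (fun j => if j == i then x else n%:R)).
    apply: measurableC; apply: bigcup_measurable => n _.
    by apply: sub_sigma_algebra; exists (fun j => if j == i then x else n%:R).
  apply/seteqP; split => v /=; rewrite in_itv/= andbT.
    by move=> xv [n _ /(_ i)]; rewrite eqxx leNgt xv.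
  move=> vx; rewrite ltNge; apply/negP => vix; apply: vx.
  have [n vn] := lower_orthant_exhaust v.
  by exists n => // j; case: eqP => [->|].
by apply.
Qed.

(** Orthants form a generating pi-system that exhausts the space, so that the
    uniqueness theorem for sigma-finite measures applies. *)
Lemma tuple_measure_unique (m1 m2 : {measure set (k.-tuple R) -> \bar R}) :
  (forall x, m1 (lower_orthant x) = m2 (lower_orthant x)) ->
  (forall x, (m1 (lower_orthant x) < +oo)%E) ->
  forall A, measurable A -> m1 A = m2 A.
Proof.
move=> m12 m1oo.
apply: (measure_unique (range lower_orthant)
  (fun n => lower_orthant (fun _ => n%:R))) => //.
- exact: measurable_tuple_orthants.
- move=> _ _ [x _ <-] [y _ <-]; exists (fun i => Num.min (x i) (y i)) => //.
  apply/seteqP; split => v /=.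
    by move=> vxy; split => i; have := vxy i; rewrite le_min => /andP[].
  by move=> [vx vy] i; rewrite le_min vx vy.
- apply/seteqP; split => // v _.
  by have [n vn] := lower_orthant_exhaust v; exists n.
- by move=> _ [x _ <-].
Qed.

End lower_orthants.

(** * Mixtures of laws given by densities *)

Lemma restrict_bigcup_nneseries (R : realType) (T : Type) (f : T -> \bar R)
    (F : (set T)^nat) (v : T) : trivIset setT F -> (forall v, (0 <= f v)%E) ->
  (f \_ (\bigcup_n F n)) v = (\sum_(n <oo) (f \_ (F n)) v)%E.
Proof.
move=> tF f0; rewrite patchE; case: ifPn => [/set_mem[n _ Fnv]|vF].
  rewrite (@nneseriesD1 _ _ n)//; last first.
    by move=> i _; exact: erestrict_ge0.
  rewrite patchE mem_set// eseries0 ?adde0// => i _ /= ni.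
  rewrite patchN//; apply/negP => /set_mem Fiv; move/eqP: ni; apply.
  by apply: tF => //; exists v.
rewrite eseries0// => i _ _; rewrite patchN//.
by apply: contra vF => /set_mem Fiv; apply/mem_set; exists i.
Qed.

Section mixture.
Context {R : realType} {d : measure_display} {X : measurableType d} (k : nat).
Variables (nu : {measure set X -> \bar R}) (g : X * k.-tuple R -> \bar R).
Hypothesis mg : measurable_fun setT g.
Hypothesis g0 : forall u, (0 <= g u)%E.
Variable C : set X.
Hypothesis mC : measurable C.

(** When C has full measure this is the law of the second component of a pair
    whose first component has law nu and whose second one has conditional
    density g (z, v) given z; C localises the first component. *)
Definition mixture (D : set (k.-tuple R)) : \bar R :=
  (\int[nu]_(z in C) iterated_integral ((fun v => g (z, v)) \_ D))%E.

Lemma measurable_iterated_integral_restrict (D : set (k.-tuple R)) :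
  measurable D ->
  measurable_fun setT (fun z => iterated_integral ((fun v => g (z, v)) \_ D)).
Proof.
move=> mD.
rewrite (_ : (fun z => _) = (fun z =>
    iterated_integral (fun v => (g \_ (setT `*` D)) (z, v)))); last first.
  apply/funext => z; congr box_integral; apply/funext => v; rewrite !patchE.
  by congr (if _ then _ else _); apply/idP/idP => /set_mem vD; apply/mem_set;
    [split|case: vD].
apply: measurable_iterated_integral; last first.
  by move=> u; apply: erestrict_ge0 => ? _; exact: g0.
have mTD : measurable ([set: X] `*` D) by exact: measurableX.
apply: (iffLR (measurable_restrictT g mTD)).
exact: measurable_funTS.
Qed.

Let mixture0 : mixture set0 = 0%E.
Proof.
apply: integral0_eq => z _; rewrite -[RHS](iterated_integral0 k).
by congr box_integral; apply/funext => v; rewrite patch_set0.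
Qed.

Let mixture_ge0 D : (0 <= mixture D)%E.
Proof.
apply: integral_ge0 => z _; apply: iterated_integral_ge0.
exact: erestrict_ge0.
Qed.

Let mixture_sigma_additive : semi_sigma_additive mixture.
Proof.
move=> F mF tF mUF.
rewrite [X in _ --> X](_ : _ = \sum_(n <oo) mixture (F n))%E.
  by apply: is_cvg_ereal_nneg_natsum => n _; exact: mixture_ge0.
rewrite /mixture -integral_nneseries//; last 2 first.
  move=> n; apply: measurable_funTS.
  exact: measurable_iterated_integral_restrict.
  move=> n z _; apply: iterated_integral_ge0; exact: erestrict_ge0.
apply: eq_integral => z _; rewrite -iterated_integral_nneseries.
- congr box_integral; apply/funext => v; exact: restrict_bigcup_nneseries.
- move=> n; apply: (iffLR (measurable_restrictT _ (mF n))).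
  apply: measurable_funTS.
  exact: (measurable_fun_pair2 z mg).
- by move=> n; exact: erestrict_ge0.
Qed.

HB.instance Definition _ := isMeasure.Build _ _ _ mixture
  mixture0 mixture_ge0 mixture_sigma_additive.

End mixture.

(** * The joint law of a bridge and of its terminal value *)

Section bridge_law.
Context {R : realType}.
Variables (S : R) (f : R -> R -> \bar R).
Hypothesis mf : forall a, 0 < a <= S -> measurable_fun [set: R] (f a).
Hypothesis f0 : forall a x, 0 < a <= S -> (0 <= f a x)%E.
Variables (k : nat) (t : nat -> R).
Hypothesis k0 : (0 < k)%N.
Hypothesis t0 : t 0%N = 0.
Hypothesis tS : forall i, (i < k)%N -> t i < t i.+1.
Hypothesis tk : t k < S.

Let t_mono i j : (i <= j)%N -> (j <= k)%N -> t i <= t j.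
Proof.
elim: j => [|j IH]; first by rewrite leqn0 => /eqP ->.
rewrite leq_eqVlt => /orP[/eqP ->//|ij jk].
exact: le_trans (IH ij (ltnW jk)) (ltW (tS jk)).
Qed.

Let t_ge0 i : (i <= k)%N -> 0 <= t i.
Proof. by rewrite -t0; exact: t_mono. Qed.

Let t_lt i : (i <= k)%N -> t i < S.
Proof. by move=> ik; apply: le_lt_trans tk; exact: t_mono. Qed.

Let step_bound (i : 'I_k) : 0 < t i.+1 - t i <= S.
Proof.
rewrite subr_gt0 tS//= lerBlDr (le_trans (ltW (t_lt (ltn_ord i))))//.
by rewrite lerDl t_ge0// ltnW.
Qed.

Let last_bound : 0 < S - t k <= S.
Proof. by rewrite subr_gt0 tk/= lerBlDr lerDl t_ge0. Qed.

Let S_bound : 0 < S <= S.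
Proof. by rewrite lexx andbT (le_lt_trans (t_ge0 (leqnn k)) tk). Qed.

Lemma bridge_density_ge0 z (y : k.-tuple R) : (0 <= bridge_density f S t z y)%E.
Proof.
rewrite /bridge_density !mule_ge0//.
- by apply: prode_ge0 => i _; apply: f0.
- exact: f0.
- by rewrite inve_ge0 f0.
Qed.

Lemma measurable_bridge_density :
  measurable_fun setT
   (fun u : measurableTypeR R * k.-tuple R => bridge_density f S t u.1 u.2).
Proof.
have mnth i : measurable_fun setT
    (fun u : measurableTypeR R * k.-tuple R => (0 :: u.2)`_i).
  case: i => [|i]; first exact: measurable_cst.
  exact: (measurableT_comp (@measurable_nth_tuple R k i)).
apply: emeasurable_funM; first apply: emeasurable_funM.
- apply: emeasurable_prod => i.
  apply: (measurableT_comp (mf (step_bound i))).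
  exact: measurable_funB (mnth _) (mnth _).
- apply: (measurableT_comp (mf last_bound)).
  by apply: measurable_funB (mnth _).
- apply: measurable_inve => [|u]; last exact: f0.
  exact: (measurableT_comp (mf S_bound)).
Qed.

Context d (T : measurableType d) (P : probability T R)
  (nu : probability (measurableTypeR R) R) (L : R -> {RV P >-> R}).
Hypothesis hL : lrb_from S nu f L.

(** The definition of the bridge prescribes the conditional probabilities of
    lower orthants; both sides are finite measures in D, hence they agree for
    every Borel set D. This generality is needed because a condition on
    increments is not a product condition on positions. *)
Theorem bridge_joint_law (D : set (k.-tuple R)) (C : set R) :
  measurable D -> measurable C ->
  P ([set w | D [tuple L (t i.+1) w | i < k]] `&` L S @^-1` C) =
  (\int[nu]_(z in C) iterated_integral (bridge_density f S t z \_ D))%E.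
Proof.
move=> mD mC.
case: hL => _ hnu hcdf.
have mY : measurable_fun setT (fun w => [tuple L (t i.+1) w | i < k]).
  exact: (measurable_mktuple (g := fun i : 'I_k => L (t i.+1))).
have mLC : measurable (L S @^-1` C) by exact: measurable_funPTI.
pose m1 := pushforward (mrestr P mLC) (fun w => [tuple L (t i.+1) w | i < k]).
transitivity (m1 D); first by [].
have g0 (u : measurableTypeR R * k.-tuple R) :
  (0 <= bridge_density f S t u.1 u.2)%E by exact: bridge_density_ge0.
pose m2 := mixture nu (fun u : measurableTypeR R * k.-tuple R =>
  bridge_density f S t u.1 u.2) C.
transitivity (m2 D); last by [].
have mg := measurable_bridge_density.
apply: (@tuple_measure_unique R k m1 m2) => //; last first.
  move=> x; apply: le_lt_trans (ltry 1%R).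
  apply: (@probability_le1 _ _ _ P); apply: measurableI => //.
  rewrite -[X in measurable X]setTI; apply: mY => //.
  exact: measurable_lower_orthant.
move=> x.
have [mcdf /(_ _ mC) hP]  := hcdf k t x k0 t0 tS tk.
transitivity (P ([set w | forall i : 'I_k, L (t i.+1) w <= x i]
                   `&` L S @^-1` C)).
  rewrite /m1 /pushforward /mrestr; congr (P (_ `&` _)).
  by apply/seteqP; split => w /= wx i; have := wx i; rewrite tnth_mktuple.
rewrite hP /m2 /mixture.
(* nu and the law of L S live on the same sigma-algebra, but are attached to two
   measurable structures on R: the image under the identity identifies them. *)
pose nu' := pushforward nu (id : measurableTypeR R -> R).
have mid :
    measurable_fun [set: measurableTypeR R] (id : measurableTypeR R -> R).
  exact: measurable_id.
transitivity (\int[nu']_(z in C) bridge_cdf f S t x z)%E.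
  by apply: eq_measure_integral => // A mA _; exact: hnu.
rewrite ge0_integral_pushforward//.
- by apply: eq_integral => z _ /=; rewrite /bridge_cdf box_integralE.
- exact: measurable_funTS.
- move=> z _; rewrite /bridge_cdf box_integralE; apply: iterated_integral_ge0.
  by apply: erestrict_ge0 => y _; exact: bridge_density_ge0.
Qed.

End bridge_law.

(** * Integration against a density *)

Section integral_density.
Import HBNNSimple.
Context d (X : measurableType d) (R : realType).
Variables (m m' : {measure set X -> \bar R}) (g : X -> \bar R).
Hypothesis mg : measurable_fun setT g.
Hypothesis g0 : forall x, (0 <= g x)%E.
Hypothesis m'E : forall A, measurable A -> m' A = (\int[m]_(x in A) g x)%E.

Let integral_density_nnsfun (h : {nnsfun X >-> R}) :
  (\int[m']_x (h x)%:E = \int[m]_x ((h x)%:E * g x))%E.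
Proof.
rewrite integralT_nnsfun sintegralE.
transitivity (\sum_(y \in range h)
    \int[m]_x ((y * \1_(h @^-1` [set y]) x)%:E * g x))%E.
  apply: eq_fsbigr => y /set_mem[x _ <-{y}].
  rewrite m'E// integral_mkcond -ge0_integralZl//; last 3 first.
  - apply: (iffLR (measurable_restrictT _ _)) => //; exact: measurable_funTS.
  - by move=> z _; exact: erestrict_ge0.
  - by rewrite lee_fin.
  apply: eq_integral => z _; rewrite EFinM -muleA; congr (_ * _)%E.
  by rewrite epatch_indic muleC.
rewrite -ge0_integral_fsum//.
- apply: eq_integral => x _; rewrite [in RHS]fimfunE -fsumEFin//.
  by rewrite ge0_mule_fsuml// => y; exact: nnfun_muleindic_ge0.
- move=> y; apply: emeasurable_funM => //.
  exact/measurable_EFinP/measurable_funM.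
- by move=> y x _; rewrite mule_ge0// nnfun_muleindic_ge0.
Qed.

(** The density may take the value +oo, which is why Radon-Nikodym derivatives
    with finite values do not cover this formula; it passes from simple
    functions to F by monotone convergence. *)
Lemma ge0_integral_density (F : X -> \bar R) :
  measurable_fun setT F -> (forall x, (0 <= F x)%E) ->
  (\int[m']_x F x = \int[m]_x (F x * g x))%E.
Proof.
move=> mF F0.
pose h := nnsfun_approx measurableT mF.
have cvgF x : (h n x)%:E @[n --> \oo] --> F x.
  by apply: cvg_nnsfun_approx => // ? _; exact: F0.
transitivity (limn (fun n => \int[m']_x (h n x)%:E)%E).
  rewrite -monotone_convergence//.
  - by apply: eq_integral => x _; apply/esym/cvg_lim => //; exact: cvgF.
  - by move=> n; exact/measurable_EFinP.
  - by move=> n x _; rewrite lee_fin.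
  - by move=> x _ a b ab; rewrite lee_fin; exact/lefP/nd_nnsfun_approx.
transitivity (limn (fun n => \int[m]_x ((h n x)%:E * g x))%E).
  by congr (limn _); apply/funext => n; exact: integral_density_nnsfun.
rewrite -monotone_convergence//.
- apply: eq_integral => x _; apply/cvg_lim => //.
  (* With g x = +oo, multiplication by g x is discontinuous at 0: the case
     F x = 0 relies on the approximation from below vanishing as well. *)
  have [gfin|] := boolP (g x \is a fin_num); first exact: cvgeZr.
  rewrite ge0_fin_numE// ltey negbK => /eqP gx.
  have [Fx0|Fx0] := eqVneq (F x) 0%E.
    rewrite Fx0 mul0e (_ : (fun n => _) = cst 0%E); first exact: cvg_cst.
    apply/funext => n /=; rewrite (_ : h n x = 0) ?mul0e//.
    apply/eqP; rewrite eq_le fun_ge0 andbT.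
    have : ((h n x)%:E <= F x)%E by rewrite nnsfun_approxE; exact: le_approx.
    by rewrite Fx0 lee_fin.
  apply: cvgeM; [|exact: cvgF|exact: cvg_cst].
  by rewrite gx; apply: neq0_mule_def; rewrite mule_eq0 (negPf Fx0).
- by move=> n; apply: emeasurable_funM => //; exact/measurable_EFinP.
- by move=> n x _; rewrite mule_ge0// lee_fin.
- move=> x _ a b ab; rewrite lee_wpmul2r// lee_fin; exact/lefP/nd_nnsfun_approx.
Qed.

End integral_density.

(** * Bridges through the law of the driving process *)

Section levy_densities_facts.
Context {R : realType} {S : R} {f : R -> R -> \bar R}.
Context d (T : measurableType d) (Q : probability T R) (X : R -> {RV Q >-> R}).
Hypothesis densX : levy_densities X S f.

Lemma levy_density_measurable a :
  0 < a <= S -> measurable_fun [set: R] (f a).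
Proof. by move=> aS; have [/(_ _ aS)[]] := densX. Qed.

Lemma levy_density_ge0 a x : 0 < a <= S -> (0 <= f a x)%E.
Proof. by move=> aS; have [/(_ _ aS)[]] := densX. Qed.

End levy_densities_facts.

Section levy_pair.
Context {R : realType}.
Variables (S : R) (f : R -> R -> \bar R).
Context d (T : measurableType d) (Q : probability T R) (X : R -> {RV Q >-> R}).
Hypothesis levyX : is_levy X.
Hypothesis densX : levy_densities X S f.
Let mu := @lebesgue_measure R.

Let mf := levy_density_measurable densX.
Let f0 := levy_density_ge0 densX.

Let measurable_increment (s u : R) (B : set R) : measurable B ->
  measurable [set w | B (X u w - X s w)].
Proof.
move=> mB.
have mg : measurable_fun setT (fun w => X u w - X s w).
  exact: measurable_funB.
by have := mg measurableT _ mB; rewrite setTI.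
Qed.

Let increment0 (s : R) (B : set R) : measurable B ->
  Q [set w | B (X s w - X 0 w)] = Q (X s @^-1` B).
Proof.
move=> mB; apply: ae_eq_measure.
- exact: measurable_increment.
- exact: measurable_funPTI.
by case: levyX => X0 _ _ _; apply: filterS X0 => w /= ->; rewrite subr0.
Qed.

Lemma levy_integral_at (s : R) (F : R -> \bar R) : 0 < s <= S ->
  measurable_fun setT F -> (forall x, (0 <= F x)%E) ->
  (\int[Q]_w F (X s w) = \int[mu]_x (F x * f s x))%E.
Proof.
move=> sS mF F0.
have mX : measurable_fun setT (X s : T -> measurableTypeR R).
  exact: (measurable_funP (X s)).
rewrite -(@ge0_integral_density _ (measurableTypeR R) R mu
  (pushforward Q (X s : T -> measurableTypeR R)))//.
- by rewrite ge0_integral_pushforward.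
- exact: mf.
- by move=> x; apply: f0.
- by move=> A mA; have [/(_ _ sS)[_ _ h] _] := densX; exact: h.
Qed.

(** Independence and stationarity of the increments make the law of
    (X_s, X_u - X_s) a product of the laws of X_s and X_(u - s). *)
Lemma levy_integral_pair (s u : R) (F : R * R -> \bar R) :
  0 < s -> s < u -> u <= S ->
  measurable_fun setT F -> (forall x, (0 <= F x)%E) ->
  (\int[Q]_w F (X s w, X u w - X s w)%R =
   \int[mu]_x ((\int[mu]_y (F (x, y) * f (u - s)%R y)) * f s x))%E.
Proof.
move=> s0 su uS mF F0.
have sS : 0 < s <= S by rewrite s0 (le_trans (ltW su)).
have usS : 0 < u - s <= S.
  by rewrite subr_gt0 su lerBlDr (le_trans uS)// lerDl ltW.
have mXs : measurable_fun setT (X s : T -> measurableTypeR R).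
  exact: (measurable_funP (X s)).
have mXus : measurable_fun setT (X (u - s) : T -> measurableTypeR R).
  exact: (measurable_funP (X (u - s))).
have mXd :
    measurable_fun setT ((fun w => X u w - X s w) : T -> measurableTypeR R).
  exact: measurable_funB.
pose pr : T -> measurableTypeR R * measurableTypeR R :=
  fun w => (X s w, X u w - X s w).
have mpr : measurable_fun setT pr by exact: measurable_fun_pair.
pose Xs : {mfun T >-> measurableTypeR R} :=
  HB.pack (X s : T -> measurableTypeR R) (isMeasurableFun.Build _ _ _ _ _ mXs).
pose Xus : {mfun T >-> measurableTypeR R} :=
  HB.pack (X (u - s) : T -> measurableTypeR R)
    (isMeasurableFun.Build _ _ _ _ _ mXus).
have mF' : measurable_fun [set: measurableTypeR R * measurableTypeR R] F by [].
transitivity (\int[pushforward Q pr]_p F p)%E.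
  by rewrite ge0_integral_pushforward.
have prE (A : set (measurableTypeR R * measurableTypeR R)) : measurable A ->
    (distribution Q Xs \x distribution Q Xus)%E A = pushforward Q pr A.
  move: A; apply: product_measure_unique => A B mA mB.
  have EA : distribution Q Xs A = Q [set w | A (X s w - X 0 w)].
    by rewrite increment0.
  have EB : distribution Q Xus B = Q [set w | B (X u w - X s w)].
    have [_ _ stat _] := levyX.
    have usu : s + (u - s) = u by rewrite addrC subrK.
    transitivity (Q [set w | B (X (s + (u - s)) w - X s w)]); last first.
      by rewrite usu.
    by rewrite stat ?increment0// ?subr_ge0 ltW.
  rewrite -[RHS]/(distribution Q Xs A * distribution Q Xus B)%E EA EB.
  transitivity (Q [set w | A (X s w - X 0 w) /\ B (X u w - X s w)]).
    apply: (@ae_eq_measure _ _ _ Q (pr @^-1` (A `*` B))).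
    - rewrite -[X in measurable X]setTI; apply: mpr => //.
      exact: measurableX.
    - by apply: measurableI; exact: measurable_increment.
    case: levyX => X0 _ _ _; apply: filterS X0 => w /= X0w.
    by rewrite /pr X0w subr0; split => -[].
  have [_ indep _ _] := levyX.
  pose tt (i : nat) : R := if i == 0%N then 0 else if i == 1%N then s else u.
  pose BB (i : 'I_2) : set R := if val i == 0%N then A else B.
  have := indep 2%N tt BB (lexx _).
  rewrite !big_ord_recl big_ord0 mule1 /BB /tt/= => <-.
  - congr (Q _); apply/seteqP; split => w /=.
      move=> [Aw Bw] i; case: i => -[|[|//]] /= i2; exact: Aw || exact: Bw.
    by move=> AB; split; [exact: AB ord0|exact: AB ord_max].
  - by move=> [|[|]].
  - by move=> [[|[|]]].
transitivity (\int[(distribution Q Xs \x distribution Q Xus)%E]_p F p)%E.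
  by apply: eq_measure_integral => A mA _; symmetry; exact: prE.
rewrite fubini_tonelli1//.
have mG : measurable_fun [set: measurableTypeR R]
    (fun x => \int[distribution Q Xus]_y F (x, y))%E.
  exact: measurable_fun_fubini_tonelli_F.
rewrite (@ge0_integral_density _ (measurableTypeR R) R mu _ (f s))//.
- apply: eq_integral => x _; congr (_ * _)%E.
  rewrite /fubini_F.
  rewrite (@ge0_integral_density _ (measurableTypeR R) R mu _ (f (u - s)))//.
  + exact: mf.
  + by move=> y; apply: f0.
  + by move=> A mA; have [/(_ _ usS)[_ _ h] _] := densX; exact: h.
  + exact: measurable_fun_pair2.
- exact: mf.
- by move=> y; apply: f0.
- by move=> A mA; have [/(_ _ sS)[_ _ h] _] := densX; exact: h.
- by move=> x; apply: integral_ge0.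
Qed.

(** The unnormalised law at time s of the bridge that ends at z has density
    f_(S - u)(z - X_u) with respect to the driving process, for any u strictly
    between s and S. The weight does not depend on s, which is what permits to
    let s tend to 0; it is obtained by splitting the step from s to S at u. *)
Lemma levy_bridge_integral (s u : R) (phi : R -> \bar R) (z : R) :
  0 < s -> s < u -> u < S ->
  measurable_fun setT phi -> (forall x, (0 <= phi x)%E) ->
  (\int[mu]_y (phi y * (f s y * f (S - s)%R (z - y)%R)) =
   \int[Q]_w (phi (X s w) * f (S - u)%R (z - X u w)%R))%E.
Proof.
move=> s0 su uS mphi phi0.
have uSS : 0 < S - u <= S.
  by rewrite subr_gt0 uS/= lerBlDr lerDl (ltW (lt_trans s0 su)).
have usS : 0 < u - s <= S.
  by rewrite subr_gt0 su/= lerBlDr (le_trans (ltW uS))// lerDl ltW.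
pose F (p : R * R) := (phi p.1 * f (S - u)%R (z - (p.1 + p.2))%R)%E.
have mF : measurable_fun setT F.
  apply: emeasurable_funM; first exact: measurableT_comp.
  apply: (measurableT_comp (mf uSS)); apply: measurable_funB => //.
  exact: measurable_funD.
transitivity (\int[Q]_w F (X s w, X u w - X s w)%R)%E; last first.
  by apply: eq_integral => w _; rewrite /F/= [X s w + _]addrC subrK.
rewrite levy_integral_pair ?ltW//; last by move=> p; rewrite mule_ge0// f0.
apply: eq_integral => y _.
have [_ hconv] := densX.
rewrite (hconv (u - s) (S - s) (z - y))
  ?subr_gt0 ?ltrD2r ?lerBlDr ?lerDl ?ltW//.
have -> : S - s - (u - s) = S - u by rewrite opprB subrKA.
rewrite muleCA [LHS]muleC; congr (_ * _)%E.
rewrite /convolution -ge0_integralZl//.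
- by apply: eq_integral => v _; rewrite muleA /F/= opprD addrA.
- apply: emeasurable_funM; last exact: mf.
  apply: (measurableT_comp (mf uSS)); exact: measurable_funB.
- by move=> v _; rewrite mule_ge0// f0.
Qed.

(** The weight of the previous lemma has total mass f_S(z); its finiteness is
    what dominated convergence requires. *)
Lemma levy_bridge_total (u z : R) : 0 < u < S ->
  (\int[Q]_w f (S - u)%R (z - X u w)%R = f S z)%E.
Proof.
move=> /andP[u0 uS].
have uSS : 0 < S - u <= S by rewrite subr_gt0 uS/= lerBlDr lerDl ltW.
have [_ /(_ u S z u0 uS (lexx _)) ->] := densX.
rewrite (levy_integral_at (s := u) (F := fun x => f (S - u) (z - x)))//.
- by rewrite u0 ltW.
- apply: (measurableT_comp (mf uSS)); exact: measurable_funB.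
- by move=> x; exact: f0.
Qed.

(** X tends to 0 at time 0, and its bridge to z inherits this in probability:
    the weight that turns X into the bridge does not depend on the early time
    and is integrable. Working for a fixed z covers the laws nu that are not
    absolutely continuous with respect to the law of X_S. *)
Lemma levy_bridge_cvg0 (s : nat -> R) (u z e : R) :
  (forall n, 0 < s n) -> (forall n, s n < u) -> s n @[n --> \oo] --> 0 ->
  u < S -> 0 < e -> (f S z < +oo)%E ->
  (\int[mu]_y ((\1_[set y | e < `|y|] y)%:E *
      (f (s n) y * f (S - s n)%R (z - y)%R)))%E @[n --> \oo] --> 0%E.
Proof.
move=> s0 su scvg uS e0 fSz.
have u0 : 0 < u by exact: lt_trans (s0 0%N) (su 0%N).
have uSS : 0 < S - u <= S by rewrite subr_gt0 uS/= lerBlDr lerDl ltW.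
have mE := measurable_norm_gt e.
have m1 :
    measurable_fun setT (fun y : R => (\1_[set y : R | e < `|y|] y : R)%:E).
  by apply/measurable_EFinP; exact: measurable_indic.
pose G w := f (S - u) (z - X u w).
have mG : measurable_fun setT G.
  by apply: (measurableT_comp (mf uSS)); exact: measurable_funB.
have G0 w : (0 <= G w)%E by exact: f0.
pose h n w := ((\1_[set y : R | e < `|y|] (X (s n) w))%:E * G w)%E.
have mh n : measurable_fun setT (h n).
  by apply: emeasurable_funM => //; exact: (measurableT_comp m1).
rewrite (_ : (fun n => _) = (fun n => \int[Q]_w h n w)%E); last first.
  by apply/funext => n; rewrite (levy_bridge_integral (u := u))//.
have iG : Q.-integrable setT G.
  apply/integrableP; split => //.
  under eq_integral do rewrite gee0_abs//.
  by rewrite levy_bridge_total ?u0.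
have [||||] := @dominated_convergence _ _ _ Q setT measurableT h (cst 0%E) G mh.
- exact: measurable_cst.
- have [X0 _ _ cad] := levyX.
  apply: filterS X0 => w X0w _.
  apply: cvg_near_cst.
  have [/(_ 0) cad0 _] := cad w S (lt_trans u0 uS).
  have {cad0} : X t w @[t --> 0^'+] --> X 0 w.
    by apply: cad0; rewrite lexx (lt_trans u0).
  move/cvg_at_rightP => /(_ s (conj s0 scvg)); rewrite X0w => /cvgr0Pnorm_lt.
  move=> /(_ _ e0); apply: filterS => n Xn.
  by rewrite /h indicE memNset ?mul0e//= => /(lt_trans Xn); rewrite ltxx.
- exact: iG.
- apply: aeW => w n _; rewrite /h gee0_abs ?mule_ge0 ?lee_fin//.
  by rewrite -[leRHS]mul1e lee_wpmul2r// lee_fin indicE lern1 leq_b1.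
by move=> _ _; rewrite integral_cst// mul0e.
Qed.

End levy_pair.

(** * Bridges start at zero *)

Section bridge_start.
Context {R : realType}.
Variables (S : R) (f : R -> R -> \bar R).
Context d (T : measurableType d) (Q : probability T R) (X : R -> {RV Q >-> R}).
Hypothesis S0 : 0 < S.
Hypothesis levyX : is_levy X.
Hypothesis densX : levy_densities X S f.
Variable nu : probability (measurableTypeR R) R.
Hypothesis fS : {ae nu, forall z, (0 < f S z < +oo)%E}.
Context d' (T' : measurableType d') (P : probability T' R)
  (L : R -> {RV P >-> R}).
Hypothesis hL : lrb_from S nu f L.
Let mu := @lebesgue_measure R.

Let mf := levy_density_measurable densX.
Let f0 := levy_density_ge0 densX.

(** When 0 < f_S(z) < +oo, this is f_S(z) times the probability that the bridge
    to z exceeds e in absolute value at time s. *)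
Let tail (e s z : R) : \bar R :=
  (\int[mu]_y ((\1_[set y : R | (e < `|y|)%R] y)%:E *
    (f s y * f (S - s)%R (z - y)%R)))%E.

Let tail_le (e s z : R) : 0 < s < S -> (tail e s z <= f S z)%E.
Proof.
move=> /andP[s0 sS].
have sSb : 0 < s <= S by rewrite s0 ltW.
have Ssb : 0 < S - s <= S by rewrite subr_gt0 sS lerBlDr lerDl ltW.
have [_ /(_ s S z s0 sS (lexx _)) ->] := densX.
have mg : measurable_fun setT (fun y : R => f (S - s) (z - y) * f s y)%E.
  apply: emeasurable_funM; last exact: mf.
  by apply: (measurableT_comp (mf Ssb)); exact: measurable_funB.
have g0 (y : R) : (0 <= f (S - s) (z - y)%R * f s y)%E by rewrite mule_ge0// f0.
apply: ge0_le_integral => //.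
- by move=> y _; rewrite !mule_ge0 ?lee_fin// f0.
- under eq_fun do rewrite [X in (_ * X)%E]muleC.
  apply: emeasurable_funM; last exact: mg.
  by apply/measurable_EFinP/measurable_indic; exact: measurable_norm_gt.
- move=> y _; rewrite [X in (_ * X)%E]muleC -[leRHS]mul1e lee_wpmul2r//.
  by rewrite lee_fin indicE lern1 leq_b1.
Qed.

Let tail_prob (e s : R) : 0 < s < S ->
  P [set w | e < `|L s w|] = (\int[nu]_z (tail e s z / f S z))%E /\
  measurable_fun [set: measurableTypeR R] (fun z => tail e s z / f S z)%E.
Proof.
move=> /andP[s0 sS].
have sSb : 0 < s <= S by rewrite s0 ltW.
have Ssb : 0 < S - s <= S by rewrite subr_gt0 sS lerBlDr lerDl ltW.
pose t (i : nat) : R := i%:R * s.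
have t0 : t 0%N = 0 by rewrite /t mul0r.
have tS i : (i < 1)%N -> t i < t i.+1.
  by move=> _; rewrite /t ltr_pM2r// ltr_nat.
have t1 : t 1%N = s by rewrite /t mul1r.
have t1S : t 1%N < S by rewrite t1.
pose D := [set v : 1.-tuple R | e < `|tnth v ord0|].
have mD : measurable D.
  have := @measurable_tnth _ R 1 ord0 measurableT _ (measurable_norm_gt e).
  by rewrite setTI.
have tailE z : (tail e s z / f S z)%E =
    iterated_integral (bridge_density f S t z \_ D).
  rewrite /tail muleC -ge0_integralZl//; last first.
  - by rewrite inve_ge0 f0// S0 lexx.
  - by move=> y _; rewrite !mule_ge0 ?lee_fin// f0.
  - apply: emeasurable_funM.
      by apply/measurable_EFinP/measurable_indic; exact: measurable_norm_gt.
    apply: emeasurable_funM; first exact: mf.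
    by apply: (measurableT_comp (mf Ssb)); exact: measurable_funB.
  apply: eq_integral => y _; rewrite epatch_indic /bridge_density.
  rewrite big_ord_recl big_ord0 mule1/= t1 t0 !subr0.
  rewrite muleC -muleA [RHS]muleC; congr (_ * _)%E.
split.
  transitivity
    (P ([set w | D [tuple L (t i.+1) w | i < 1]] `&` L S @^-1` setT)).
    rewrite preimage_setT setIT; congr (P _); apply/seteqP.
    by split => w /=; rewrite /D/= tnth_mktuple/= t1.
  rewrite (bridge_joint_law mf f0 _ t0 tS t1S hL mD)//.
  by apply: eq_integral => z _; rewrite tailE.
under eq_fun do rewrite tailE.
apply: (measurable_iterated_integral_restrict (g := fun u =>
   bridge_density f S t u.1 u.2)) => //.
  exact: measurable_bridge_density.
by move=> u; exact: bridge_density_ge0.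
Qed.

(** The finite-dimensional laws of the bridge say nothing about time 0. By right
    continuity L_0 is a limit of L_(s_n) with s_n decreasing to 0, and these
    variables tend to 0 in probability: their tails are nu-averages of the
    tails of the pinned bridges, each of which is at most 1 and tends to 0. *)
Lemma lrb_start_zero : {ae P, forall w, L 0 w = 0}.
Proof.
pose u := S / 2.
have uS : u < S by rewrite /u gtr_pMr// invf_lt1// ltr1n.
have u0 : 0 < u by rewrite divr_gt0.
(* The factor 1 / 2 makes the first term smaller than u. *)
pose s n : R := (u / 2) * harmonic n.
have s0 n : 0 < s n.
  by rewrite /s mulr_gt0 ?divr_gt0// /harmonic invr_gt0.
have su n : s n < u.
  apply: (@le_lt_trans _ _ (u / 2)); last by rewrite gtr_pMr// invf_lt1// ltr1n.
  rewrite /s ger_pMr ?divr_gt0// /harmonic invf_le1// ler1n//.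
have scvg : s n @[n --> \oo] --> 0.
  by rewrite -[X in _ --> X](mulr0 (u / 2)); apply: cvgMr; exact: cvg_harmonic.
have sS n : 0 < s n < S by rewrite s0 (lt_trans (su n)).
have aeF := ae_filter_ringOfSetsType nu.
have Pcvg e : 0 < e -> P [set w | e < `|L (s n) w|] @[n --> \oo] --> 0%E.
  move=> e0.
  under eq_fun do rewrite (tail_prob e (sS _)).1.
  have [||||] := @dominated_convergence _ _ _ nu setT measurableT
    (fun n z => tail e (s n) z / f S z)%E (cst 0%E) (cst 1%E)
    (fun n => (tail_prob e (sS n)).2).
  - exact: measurable_cst.
  - apply: (@filterS _ _ aeF _ _ _ fS) => z /andP[fz0 fzoo] _.
    have ffin : f S z \is a fin_num by rewrite ge0_fin_numE// ltW.
    rewrite -[X in _ --> X](mul0e (f S z)^-1).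
    apply: cvgeZr.
      by apply: fin_numV; rewrite gt_eqF// (lt_trans _ fz0)// ltNyr.
    exact: (levy_bridge_cvg0 levyX densX (u := u)).
  - exact: finite_measure_integrable_cst.
  - apply: (@filterS _ _ aeF _ _ _ fS) => z /andP[fz0 fzoo] n _.
    have ffin : f S z \is a fin_num by rewrite ge0_fin_numE// ltW.
    rewrite gee0_abs; last first.
      rewrite mule_ge0 ?inve_ge0 ?(ltW fz0)//; apply: integral_ge0 => y _.
      have /andP[sn0 snS] := sS n.
      have snb : 0 < s n <= S by rewrite sn0 ltW.
      have Ssnb : 0 < S - s n <= S by rewrite subr_gt0 snS lerBlDr lerDl ltW.
      by rewrite !mule_ge0 ?lee_fin// f0.
    rewrite -(divee ffin) ?gt_eqF// lee_wpmul2r ?tail_le//.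
    by rewrite inve_ge0 ltW.
  by move=> _ _; rewrite integral_cst// mul0e.
have mLe (r e : R) : measurable [set w | e < `|L r w|].
  have := @measurable_funPTI _ _ _ _ (L r) _ (measurable_norm_gt e).
  by [].
have Lcvg w : L (s n) w @[n --> \oo] --> L 0 w.
  have [cad _ _] := hL; have [/(_ 0) cad0 _] := cad w.
  have /cvg_at_rightP : L t w @[t --> 0^'+] --> L 0 w.
    by apply: cad0; rewrite lexx.
  by apply.
have Pe e : 0 < e -> P [set w | e < `|L 0 w|] = 0%E.
  move=> e0.
  (* By right continuity, if L exceeds e at time 0 then it does so along the
     sequence s from some rank N on. *)
  pose E N := \bigcap_(n in [set n | (N <= n)%N]) [set w | e < `|L (s n) w|].
  have mE N : measurable (E N).
    by apply: bigcap_measurable => //; exists N => /=.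
  have PE N : P (E N) = 0%E.
    apply/eqP; rewrite -measure_le0; apply: (cvge_ge _ (Pcvg e e0)).
    exists N => // n Nn; apply: le_measure; rewrite ?inE//.
    by move=> w; apply.
  apply/negligibleP => //.
  apply: (@negligibleS _ _ _ _ (\bigcup_N E N)); last first.
    by apply: negligible_bigcup => N; apply/(negligibleP _ (mE N)); exact: PE.
  move=> w /= ew.
  have /cvgr_norm_gt /(_ _ ew)[N _ NL] := Lcvg w.
  by exists N => // n /= Nn; exact: NL.
apply: (@negligibleS _ _ _ _ (\bigcup_n [set w | n.+1%:R^-1 < `|L 0 w|])).
  move=> w /= /eqP; rewrite -normr_gt0 => /ltr_add_invr[n].
  by rewrite add0r => nLw; exists n.
apply: negligible_bigcup => n; apply/negligibleP => //.
by apply: Pe; rewrite invr_gt0.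
Qed.

End bridge_start.

(** * The increments of a bridge along a partition *)

Section liouville_of_bridge.
Context {R : realType} (M : nat).
Variables (S : R) (tau : nat -> R).
Hypothesis M0 : (0 < M)%N.
Hypothesis tau0 : tau 0%N = 0.
Hypothesis tauS : forall i, (i < M.+1)%N -> tau i < tau i.+1.
Hypothesis tauM : tau M.+1 = S.

(** The conditional density of the first M coordinates of a generalised
    multivariate Liouville vector given that all its coordinates sum to z. *)
Definition liouville_integrand (phi : R -> R -> \bar R) (a : 'I_M.+1 -> R)
    (z : R) (x : M.-tuple R) : \bar R :=
  (phi (a ord_max) (z - \sum_(i < M) tnth x i)%R / phi (\sum_i a i)%R z *
   \prod_(i < M) phi (a (widen_ord (leqnSn M) i)) (tnth x i))%E.

Definition time_step (i : 'I_M.+1) : R := tau i.+1 - tau i.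

Lemma sum_time_step : \sum_i time_step i = S.
Proof.
have := telescope_sumr tau (leq0n M.+1).
by rewrite tau0 tauM subr0 big_mkord.
Qed.

(** Only the increments of the positions enter the transition densities, and the
    last position is the sum of the increments. *)
Lemma bridge_density_liouville (f : R -> R -> \bar R) (z : R) (y : M.-tuple R) :
  bridge_density f S tau z y =
  liouville_integrand f time_step z (increments_from 0 y).
Proof.
have E (i : 'I_M) : tnth (increments_from 0 y) i =
    (0 :: val y)`_i.+1 - (0 :: val y)`_i.
  by rewrite tnth_mktuple/= (tnth_nth 0).
rewrite /bridge_density /liouville_integrand sum_time_step -muleA muleC.
congr (_ * _)%E.
  rewrite /time_step/= tauM (eq_bigr _ (fun i _ => E i)).
  rewrite -(big_mkord xpredT (fun i => (0 :: val y)`_i.+1 - (0 :: val y)`_i)).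
  by rewrite telescope_sumr//= subr0.
by apply: eq_bigr => i _; rewrite E.
Qed.

Lemma time_step_gt0 (i : 'I_M.+1) : 0 < time_step i.
Proof. by rewrite subr_gt0 tauS. Qed.

Lemma time_step_le (i : 'I_M.+1) : time_step i <= S.
Proof.
rewrite -sum_time_step (bigD1 i)//= lerDl sumr_ge0// => j _.
by rewrite ltW// time_step_gt0.
Qed.

Let S0 : 0 < S.
Proof. exact: lt_le_trans (time_step_gt0 ord0) (time_step_le ord0). Qed.

Context d (T : measurableType d) (Q : probability T R) (X : R -> {RV Q >-> R}).
Variable f : R -> R -> \bar R.
Hypothesis levyX : is_levy X.
Hypothesis densX : levy_densities X S f.
Variable nu : probability (measurableTypeR R) R.
Hypothesis fS : {ae nu, forall z, (0 < f S z < +oo)%E}.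
Context d' (T' : measurableType d') (P : probability T' R)
  (L : R -> {RV P >-> R}).
Hypothesis hL : lrb_from S nu f L.

Let mf := levy_density_measurable densX.
Let f0 := levy_density_ge0 densX.

Lemma liouville_integrand_ge0 z x :
  (0 <= liouville_integrand f time_step z x)%E.
Proof.
rewrite /liouville_integrand !mule_ge0//.
- by rewrite f0// time_step_gt0 time_step_le.
- by rewrite inve_ge0 f0// sum_time_step S0 lexx.
- by apply: prode_ge0 => i _; rewrite f0// time_step_gt0 time_step_le.
Qed.

Lemma measurable_liouville_integrand z :
  measurable_fun setT (liouville_integrand f time_step z).
Proof.
apply: emeasurable_funM; first apply: emeasurable_funM.
- have sb : 0 < time_step ord_max <= S by rewrite time_step_gt0 time_step_le.
  apply: (measurableT_comp (mf sb)); apply: measurable_funB => //.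
  by apply: measurable_sum => i; exact: measurable_tnth.
- exact: measurable_cst.
- apply: emeasurable_prod => i.
  have sb : 0 < time_step (widen_ord (leqnSn M) i) <= S.
    by rewrite time_step_gt0 time_step_le.
  apply: (measurableT_comp (mf sb)); exact: measurable_tnth.
Qed.

Definition liouville_event (B : 'I_M -> set R) (C : set R) :
    set (M.+1.-tuple R) :=
  [set v | (forall i, B i (tnth v (widen_ord (leqnSn M) i))) /\
           C (\sum_i tnth v i)].

Lemma measurable_liouville_event (B : 'I_M -> set R) (C : set R) :
  (forall i, measurable (B i)) -> measurable C ->
  measurable (liouville_event B C).
Proof.
move=> mB mC.
apply: (@measurableI _ _ [set v : M.+1.-tuple R | forall i, B i (tnth v _)]
  [set v | C (\sum_i tnth v i)]).
  rewrite (_ : mkset _ =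
    (fun v : M.+1.-tuple R => [tuple tnth v (widen_ord (leqnSn M) i) | i < M])
      @^-1` [set v | forall i, B i (tnth v i)]); last first.
    by apply/seteqP; split => v vB i; have := vB i; rewrite tnth_mktuple.
  rewrite -[X in measurable X]setTI.
  have : measurable_fun setT (fun v : M.+1.-tuple R =>
      [tuple tnth v (widen_ord (leqnSn M) i) | i < M]).
    by apply: measurable_mktuple => i; exact: measurable_tnth.
  by apply => //; exact: measurable_box.
have : measurable_fun setT (fun v : M.+1.-tuple R => \sum_i tnth v i).
  by apply: measurable_sum => i; exact: measurable_tnth.
by move=> /(_ measurableT _ mC); rewrite setTI.
Qed.

(** As L_0 vanishes almost surely, the increments are determined by the
    positions at the interior times and by L_S; the change of variables from
    positions to increments then turns the bridge density into the Liouville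
    density. *)
Lemma liouville_of_bridge (B : 'I_M -> set R) (C : set R) :
  (forall i, measurable (B i)) -> measurable C ->
  P [set w | liouville_event B C
       [tuple L (tau i.+1) w - L (tau i) w | i < M.+1]] =
  (\int[nu]_(z in C) box_integral B (liouville_integrand f time_step z))%E.
Proof.
move=> mB mC.
pose D := [set v : M.-tuple R | forall i, B i (tnth (increments_from 0 v) i)].
have mincr : measurable_fun setT (fun v : M.-tuple R => increments_from 0 v).
  apply: measurable_mktuple => i.
  apply: measurable_funB; first exact: measurable_tnth.
  by case: (i : nat) => [|j] /=; [exact: measurable_cst|
    exact: measurable_nth_tuple].
have mD : measurable D.
  by have := mincr measurableT _ (measurable_box mB); rewrite setTI.
transitivity (P ([set w | D [tuple L (tau i.+1) w | i < M]] `&` L S @^-1` C)).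
  apply: ae_eq_measure.
  - rewrite -[X in measurable X]setTI.
    apply: (measurable_mktuple
      (g := fun (i : 'I_M.+1) w => L (tau i.+1) w - L (tau i) w)) => //.
    + by move=> i; exact: measurable_funB.
    + exact: measurable_liouville_event.
  - apply: measurableI; last exact: measurable_funPTI.
    rewrite -[X in measurable X]setTI.
    exact: (measurable_mktuple (g := fun i : 'I_M => L (tau i.+1))).
  apply: filterS (lrb_start_zero S0 levyX densX fS hL) => w L0.
  have Etau (i : 'I_M) :
      tnth (increments_from 0 [tuple L (tau i.+1) w | i < M]) i =
      L (tau i.+1) w - L (tau i) w.
    rewrite tnth_mktuple tnth_mktuple; congr (_ - _).
    case: i => -[|j] iM /=; first by rewrite tau0 L0.
    transitivity (tnth [tuple L (tau i.+1) w | i < M] (Ordinal (ltnW iM))).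
      by rewrite (tnth_nth 0).
    by rewrite tnth_mktuple.
  have Esum :
      \sum_i tnth [tuple L (tau i.+1) w - L (tau i) w | i < M.+1] i = L S w.
    rewrite (eq_bigr (fun i : 'I_M.+1 => L (tau i.+1) w - L (tau i) w)).
      have := telescope_sumr (fun i => L (tau i) w) (leq0n M.+1).
      by rewrite big_mkord tau0 L0 subr0 tauM.
    by move=> i _; rewrite tnth_mktuple.
  rewrite /liouville_event /D/= Esum; split=> -[wB wC]; split => // i;
    by have := wB i; rewrite Etau tnth_mktuple.
rewrite (bridge_joint_law mf f0 M0 tau0 _ _ hL mD mC); last 2 first.
  by move=> i iM; apply: tauS; exact: leqW.
  by rewrite -tauM tauS.
apply: eq_integral => z _; rewrite box_integralE.
set h := (X in _ = iterated_integral X).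
rewrite -(iterated_integral_increments 0 (g := h)).
- congr box_integral; apply/funext => y; rewrite /h !patchE.
  by rewrite bridge_density_liouville.
- apply: (iffLR (measurable_restrictT _ (measurable_box mB))).
  by apply: measurable_funTS; exact: measurable_liouville_integrand.
- by move=> v; apply: erestrict_ge0 => x _; exact: liouville_integrand_ge0.
Qed.

End liouville_of_bridge.

(** * Generalised Liouville processes *)

Section partial_sums.
Context {R : realType} (N : nat) (a : 'I_N -> R).

Lemma partial_sum0 : partial_sum a 0 = 0.
Proof. exact: big_pred0_eq. Qed.

Lemma partial_sumS (i : 'I_N) : partial_sum a i.+1 = partial_sum a i + a i.
Proof.
rewrite /partial_sum (bigD1 i)//= addrC; congr (_ + _).
by apply: eq_bigl => j; rewrite ltnS andbC ltn_neqAle.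
Qed.

Lemma partial_sum_total : partial_sum a N = \sum_i a i.
Proof. by apply: eq_bigl => i; rewrite ltn_ord. Qed.

End partial_sums.

(** The transition densities of the driving process serve as the convolution
    family. The hypothesis on X only involves laws, so that it can be
    transported between probability spaces. *)
Lemma liouville_of_lrb (R : realType) (N : nat) (a : 'I_N -> R)
    (nu : probability (measurableTypeR R) R)
    d (T : measurableType d) (P : probability T R)
    d' (T' : measurableType d') (P' : probability T' R)
    (L : R -> {RV P' >-> R}) (X : 'I_N -> T -> R) :
  (1 < N)%N -> (forall i, 0 < a i) -> is_lrb (partial_sum a N) nu L ->
  (forall D : set (N.-tuple R), measurable D ->
    P [set w | D [tuple X i w | i < N]] =
    P' [set w | D [tuple L (partial_sum a i.+1) w - L (partial_sum a i) w
                  | i < N]]) ->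
  gen_multivariate_liouville P X.
Proof.
case: N a X => [//|M] a X M0 a0 [S0 [dQ [TQ [Q [Y [f]]]]]].
move=> [levyY densY fS hL] law.
set S := partial_sum a M.+1 in S0 densY fS hL.
pose tau := partial_sum a.
have tau0 : tau 0%N = 0 by exact: partial_sum0.
have tauS i : (i < M.+1)%N -> tau i < tau i.+1.
  by move=> iM; rewrite /tau (partial_sumS a (Ordinal iM)) ltrDl.
have stepE i : time_step tau i = a i.
  by rewrite /time_step /tau partial_sumS addrC addKr.
have sum_a : \sum_i a i = S by rewrite /S partial_sum_total.
exists nu, S, f, a; split => //.
- have [dens conv] := densY; split.
  + by move=> b bS; have [] := dens b bS.
  + by move=> b x bS; have [] := dens b bS.
  + move=> b c x b0 c0 bcS.
    by rewrite (conv c (b + c) x)// ?ltrDr// addrK.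
- by split => //; rewrite sum_a.
- by rewrite sum_a.
move=> B C mB mC.
transitivity (P [set w | liouville_event B C [tuple X i w | i < M.+1]]).
  congr (P _); apply/seteqP; rewrite /liouville_event/=.
  split => w /=; rewrite (eq_bigr _ (fun i _ => tnth_mktuple (X ^~ w) i)).
    by move=> [wB wC]; split => // i; rewrite tnth_mktuple.
  by move=> [wB wC]; split => // i; have := wB i; rewrite tnth_mktuple.
rewrite law; last exact: measurable_liouville_event.
rewrite (liouville_of_bridge M0 tau0 tauS _ levyY densY fS hL mB mC)//.
apply: eq_integral => z _; congr box_integral; apply/funext => x.
by rewrite (funext stepE : time_step tau = a).
Qed.

(** Evaluating the process at the N right end points followed by the N left end
    points expresses a family of increments through finitely many values. *)
Lemma equal_in_law_differences d d' (T : measurableType d)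
    (T' : measurableType d') (R : realType) (P : probability T R)
    (P' : probability T' R) (n : nat) (xi : 'I_n -> R -> T -> R)
    (zeta : 'I_n -> R -> T' -> R) (N : nat) (c : 'I_N -> 'I_n)
    (r s : 'I_N -> R) (D : set (N.-tuple R)) :
  equal_in_law P P' xi zeta ->
  (forall j, 0 <= r j <= 1) -> (forall j, 0 <= s j <= 1) -> measurable D ->
  P [set w | D [tuple xi (c j) (s j) w - xi (c j) (r j) w | j < N]] =
  P' [set w | D [tuple zeta (c j) (s j) w - zeta (c j) (r j) w | j < N]].
Proof.
move=> law r01 s01 mD.
pose c' (x : 'I_(N + N)) :=
  match fintype.split x with inl j => c j | inr j => c j end.
pose t' (x : 'I_(N + N)) :=
  match fintype.split x with inl j => s j | inr j => r j end.
pose diff (v : (N + N).-tuple R) :=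
  [tuple tnth v (lshift N j) - tnth v (rshift N j) | j < N].
have mdiff : measurable_fun setT diff.
  apply: measurable_mktuple => j.
  by apply: measurable_funB; exact: measurable_tnth.
have splitl (j : 'I_N) : fintype.split (lshift N j) = inl j.
  exact: (unsplitK (inl j)).
have splitr (j : 'I_N) : fintype.split (rshift N j) = inr j.
  exact: (unsplitK (inr j)).
have diffE U (x : 'I_n -> R -> U -> R) w :
    diff [tuple x (c' j) (t' j) w | j < N + N] =
    [tuple x (c j) (s j) w - x (c j) (r j) w | j < N].
  apply: eq_from_tnth => j; rewrite !tnth_mktuple.
  by rewrite /c' /t' splitl splitr.
have := law _ c' t' (diff @^-1` D).
rewrite /preimage/=.
under [X in P X]eq_set do rewrite diffE.
under [X in P' X]eq_set do rewrite diffE.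
apply.
  by move=> x; rewrite /t'; case: fintype.split.
by have := mdiff measurableT _ mD; rewrite setTI.
Qed.

Section partition_times.
Context {R : realType} (n : nat) (m : 'I_n -> R) (k : 'I_n -> nat)
  (t : 'I_n -> nat -> R).
Hypothesis t0 : forall i, t i 0%N = 0.
Hypothesis t1 : forall i, t i (k i) = 1.

(** The durations, on the time scale of the bridge, of the increments of the
    generalised Liouville process listed coordinate by coordinate. *)
Definition bridge_steps (s : 'I_(\sum_i k i)) : R :=
  let i := tagnat.sig1 s in
  let j := tagnat.sig2 s : nat in (t i j.+1 - t i j) * m i.

Let sum_coord (i : 'I_n) (j : nat) :
  \sum_(0 <= l < j) (t i l.+1 - t i l) * m i = t i j * m i.
Proof. by rewrite -mulr_suml telescope_sumr// t0 subr0. Qed.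

Lemma sum_bridge_steps : \sum_s bridge_steps s = \sum_i m i.
Proof.
rewrite (reindex _ tagnat.rank_bij_on)/=.
transitivity (\sum_i \sum_(j < k i) (t i j.+1 - t i j) * m i).
  rewrite sig_big_dep/=; apply: eq_bigr => -[i j] _.
  by rewrite /bridge_steps /tagnat.sig1 /tagnat.sig2 tagnat.rankK.
apply: eq_bigr => i _.
rewrite -(big_mkord xpredT (fun l => (t i l.+1 - t i l) * m i)).
by rewrite sum_coord t1 mul1r.
Qed.

(** The intervals traversed by successive coordinates are contiguous: before
    the interval number j of coordinate i come all of those of the coordinates
    before i, which last m_i' each, and the first j ones of coordinate i. *)
Lemma partial_sum_bridge_steps (s : 'I_(\sum_i k i)) :
  partial_sum bridge_steps s =
  t (tagnat.sig1 s) (tagnat.sig2 s) * m (tagnat.sig1 s) +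
  partial_sum m (tagnat.sig1 s).
Proof.
set i0 := tagnat.sig1 s; set j0 := tagnat.sig2 s.
rewrite /partial_sum [LHS](reindex _ (onW_bij _ tagnat.rank_bij))/=.
pose pair i (j : 'I_(k i)) := Tagged (fun i => 'I_(k i)) j.
transitivity (\sum_i \sum_(j < k i | (pair i j < tagnat.sig s)%O)
   (t i j.+1 - t i j) * m i).
  rewrite sig_big_dep/=; apply: eq_big => -[i j].
    transitivity (tagnat.rank (pair i j) < tagnat.rank (tagnat.sig s))%O.
      by rewrite tagnat.sigK ltEord.
    by rewrite tagnat.lt_rank.
  by move=> _; rewrite /bridge_steps /tagnat.sig1 /tagnat.sig2 tagnat.rankK.
have sE : tagnat.sig s = pair i0 j0 by rewrite tagnat.sigE12.
rewrite (bigD1 i0)//=; congr (_ + _).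
  rewrite (eq_bigl (fun j : 'I_(k i0) => (j < j0)%N)); last first.
    by move=> j; rewrite sE ltEsig/= !lexx/= tagged_asE ltEord.
  pose F l := (t i0 l.+1 - t i0 l) * m i0.
  rewrite -(big_ord_widen _ F (ltnW (ltn_ord j0))).
  by rewrite -(big_mkord xpredT F) sum_coord.
rewrite [LHS](bigID (fun i : 'I_n => (i < i0)%N))/= [X in _ + X]big1 ?addr0.
  apply: eq_big => i; first by rewrite -val_eqE ltn_neqAle andbA andbb.
  move=> /andP[_ ii0].
  transitivity (\sum_(j < k i) (t i j.+1 - t i j) * m i).
    apply: eq_bigl => j; rewrite sE ltEsig/= leEord (ltnW ii0)/=.
    by rewrite leqNgt ii0.
  rewrite -(big_mkord xpredT (fun l => (t i l.+1 - t i l) * m i)).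
  by rewrite sum_coord t1 mul1r.
move=> i /andP[ii0]; rewrite -leqNgt => i0i; rewrite big_pred0// => j.
rewrite sE ltEsig/= leEord leqNgt ltn_neqAle i0i andbT.
by rewrite -val_eqE eq_sym in ii0; rewrite ii0.
Qed.

End partition_times.

Theorem proposition3p4 (R : realType) (n : nat) (hn : (2 <= n)%N)
    (m : 'I_n -> R) (hm : forall i, 0 < m i)
    (nu : probability (measurableTypeR R) R)
    (hnu : no_continuous_singular_part nu)
    (d : measure_display) (T : measurableType d) (P : probability T R)
    (xi : 'I_n -> R -> {RV P >-> R}) (hxi : is_glp nu m xi) :
  (forall (k : 'I_n -> nat) (t : 'I_n -> nat -> R),
     (forall i, (1 <= k i)%N) ->
     (forall i, t i 0%N = 0) ->
     (forall i, t i (k i) = 1) ->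
     (forall i j, (j < k i)%N -> t i j < t i j.+1) ->
     gen_multivariate_liouville P (increments xi k t)) /\
  gen_multivariate_liouville P (fun i => xi i 1).
Proof.
have [_ [d' [T' [P' [L [hlrb law]]]]]] := hxi.
split=> [k t k1 t0 t1 tinc|].
  have step_gt0 (s : 'I_(\sum_i k i)) : 0 < bridge_steps m t s.
    rewrite /bridge_steps; apply: mulr_gt0; last exact: hm.
    by rewrite subr_gt0; apply: tinc; exact: ltn_ord.
  have tmono i j l : (j <= l)%N -> (l <= k i)%N -> t i j <= t i l.
    elim: l => [|l IH]; first by rewrite leqn0 => /eqP ->.
    rewrite leq_eqVlt => /orP[/eqP ->//|jl lk].
    exact: le_trans (IH jl (ltnW lk)) (ltW (tinc _ _ lk)).
  have t01 i j : (j <= k i)%N -> 0 <= t i j <= 1.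
    by move=> jk; rewrite -(t0 i) -(t1 i) !tmono.
  have N1 : (1 < \sum_i k i)%N.
    apply: (leq_trans hn); rewrite -[leqLHS]card_ord -sum1_card.
    by apply: leq_sum => i _.
  apply: (@liouville_of_lrb _ _ (bridge_steps m t) nu _ _ _ _ _ _ L) => //.
    by rewrite partial_sum_total (sum_bridge_steps _ t0 t1) -partial_sum_total.
  move=> D mD.
  have := @equal_in_law_differences _ _ _ _ _ _ _ _ _ _ _ (@tagnat.sig1 n k)
    (fun s => t (tagnat.sig1 s) (tagnat.sig2 s))
    (fun s => t (tagnat.sig1 s) (tagnat.sig2 s).+1) _ law _ _ mD.
  rewrite /increments => ->.
  - congr (P' _); apply: eq_set => w; congr (D _); apply: eq_from_tnth => s.
    rewrite !tnth_mktuple opprB addrA subrK.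
    rewrite partial_sumS (partial_sum_bridge_steps _ t0 t1).
    congr (L _ w - _); rewrite /bridge_steps.
    by rewrite mulrBl addrAC addrCA subrr addr0.
  - by move=> s; apply: t01; exact: ltnW (ltn_ord _).
  - by move=> s; apply: t01; exact: ltn_ord.
(* At time 1 coordinate i is the whole increment of the bridge over the interval
   of length m_i, so that the terminal values use the partition into the
   intervals of the coordinates. *)
apply: (@liouville_of_lrb _ _ m nu _ _ _ _ _ _ L) => // D mD.
rewrite (law n id (fun _ => 1) D)//.
  congr (P' _); apply: eq_set => w; congr (D _); apply: eq_from_tnth => i.
  by rewrite !tnth_mktuple mul1r partial_sumS [m _ + _]addrC.
by move=> j; rewrite ler01 lexx.
Qed.
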